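(* The map $\mathcal{P}:\mathbf{SDS}\to\mathbf{OBD}$ is a contravariant functor.
   Context: **Bratteli diagrams.** A Bratteli diagram $(V,E)$ consists of a vertex set $V=V_0\sqcup V_1\sqcup\cdots$ with each $V_n$ finite and non-empty and $V_0$ a singleton, and an edge set $E=E_1\sqcup E_2\sqcup\cdots$ with each $E_n$ finite and non-empty, together with maps $r,s:E\to V$ (range, source) such that $r(E_n)\subseteq V_n$, $s(E_n)\subseteq V_{n-1}$, $s^{-1}\{v\}\neq\varnothing$ for all $v\in V$ and $r^{-1}\{v\}\ne\varnothing$ for all $v\in V\setminus V_0$. An ordered Bratteli diagram $(V,E,\geq)$ is a Bratteli diagram with a partial order on $E$ such that $e,e'$ are comparable iff $r(e)=r(e')$. **Edge sets.** An ordered edge set from a finite set $S$ to a finite set $T$ is a finite set $F$ with maps $s:F\to S$, $r:F\to T$ and a linear order on each $r^{-1}\{w\}$, $w\in T$. If $G$ is an ordered edge set from $T$ to $U$, then $F\circ G=\{(e,g)\in F\times G: r(e)=s(g)\}$, with source $s(e)$, range $r(g)$, and order: for $r(g)=r(g')$, $(e,g)<(e',g')$ iff $g<g'$, or $g=g'$ and $e<e'$. Write $F\cong F'$ if there is a bijection $F\to F'$ preserving sources, ranges and order. For $k<l$, $E_{k,l}=E_{k+1}\circ\cdots\circ E_l$; $E_{k,k}$ consists of one edge from $v$ to $v$ for each $v\in V_k$. **The category $\mathbf{OBD}$.** Objects: ordered Bratteli diagrams. An ordered premorphism $f:B=(V,E,\ge)\to C=(W,S,\ge)$ is a triple $(F,(f_n)_{n\ge0},\geq)$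 where $(f_n)$ is an unbounded sequence of integers with $0=f_0\le f_1\le\cdots$, and $F=F_0\sqcup F_1\sqcup\cdots$ where each $F_n$ is a non-empty finite ordered edge set from $V_n$ to $W_{f_n}$ such that every $v\in V_n$ is the source of some edge of $F_n$ (that is, $s^{-1}\{v\}\neq\varnothing$ for all $v\in V$) and every $w\in W_{f_n}$ is the range of some edge of $F_n$, $F_0$ is a singleton, and $E_{n+1}\circ F_{n+1}\cong F_n\circ S_{f_n,f_{n+1}}$ for all $n\ge0$. The composition of $f:B\to C$ and $g=(G,(g_n),\ge):C\to D$ is $gf=(H,(h_n),\ge)$ with $h_n=g_{f_n}$, $H_n=F_n\circ G_{f_n}$. Premorphisms $f,g:B\to C$ are equivalent if there are positive integers $n_1<m_1<n_2<m_2<\cdots$ with $f_{n_k}<g_{m_k}<f_{n_{k+1}}$ and, for all $k\ge1$, $E_{n_k,m_k}\circ G_{m_k}\cong F_{n_k}\circ S_{f_{n_k},g_{m_k}}$ and $E_{m_k,n_{k+1}}\circ F_{n_{k+1}}\cong G_{m_k}\circ S_{g_{m_k},f_{n_{k+1}}}$. Morphisms in $\mathbf{OBD}$ are equivalence classes $[f]$, with $[g][f]=[gf]$. **The category $\mathbf{SDS}$.** An essentially minimal totally disconnected dynamical system $(X,\varphi,x_0)$ consists of a metrizable compact totally disconnected space $X$, a homeomorphism $\varphi$ of $X$ such that $(X,\varphi)$ has a unique minimal (non-empty closed invariant) subset, and a point $x_0$ of that subset. A Kakutani–Rokhlin partition for it is a finite partition $P=\{Z(k,j): 1\le k\le K,\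 1\le j\le J(k)\}$ of $X$ into non-empty clopen sets with $\varphi(Z(k,j))=Z(k,j+1)$ for $1\le j<J(k)$, and such that the top $Z=\bigcup_kZ(k,J(k))$ contains $x_0$ and $\varphi(Z)=\bigcup_kZ(k,1)$; the sequences $(Z(k,1),\ldots,Z(k,J(k)))$ are its towers. A system of Kakutani–Rokhlin partitions is a sequence $\mathcal{R}=(P_n)_{n\ge0}$ of such partitions with $P_0=\{X\}$, $P_{n+1}$ refining $P_n$ (written $P_n\le P_{n+1}$), the tops $Z_n$ of $P_n$ ($n\ge1$) decreasing with intersection $\{x_0\}$, and $\bigcup_nP_n$ a basis for the topology of $X$. Objects of $\mathbf{SDS}$ are quadruples $(X,\varphi,x_0,\mathcal{R})$; morphisms $(X,\varphi,x_0,\mathcal{R})\to(Y,\psi,y_0,\mathcal{S})$ are continuous maps $\alpha:X\to Y$ with $\alpha\circ\varphi=\psi\circ\alpha$ and $\alpha(x_0)=y_0$. **The edge set $E(P,Q)$.** If $P\le Q$ are Kakutani–Rokhlin partitions and the top of $P$ contains the top of $Q$, $E(P,Q)$ is the set of triples $(S,T,k)$ with $S=(Z_1,\ldots,Z_n)$ a tower of $P$, $T=(Y_1,\ldots,Y_m)$ a tower of $Q$, $k\ge0$ an integer with $Y_{k+j}\subseteq Z_j$ for $1\le j\le n$; source $S$, range $T$, and $(S,T,k)\le(S',T',k')$ iff $T=T'$ and $k\le k'$. **The map $\mathcal{P}$.** On objects with $\mathcal{R}=(P_n)$: $\mathcal{P}(X,\varphi,x_0,\mathcal{R})$ is the ordered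 Bratteli diagram with $V_n=\{(n,T): T\text{ a tower of }P_n\}$ and $E_n$ the copy $\{(n,S,T,k):(S,T,k)\in E(P_{n-1},P_n)\}$ of $E(P_{n-1},P_n)$ with its order. For a morphism $\alpha:(X,\varphi,x_0,(P_n))\to(Y,\psi,y_0,(Q_n))$, let $\alpha^{-1}(Q_n)$ be the set of inverse images of elements of $Q_n$, a Kakutani–Rokhlin partition for $(X,\varphi,x_0)$; for a tower $S=(Z_1,\ldots,Z_m)$ of $Q_n$ write $\alpha^{-1}(S)=(\alpha^{-1}(Z_1),\ldots,\alpha^{-1}(Z_m))$. Choose integers $0=f_0\le f_1\le\cdots$, unbounded, with $\alpha^{-1}(Q_n)\le P_{f_n}$ and the top of $\alpha^{-1}(Q_n)$ containing the top of $P_{f_n}$; let $F_n=\{(n,S,T,k):(\alpha^{-1}(S),T,k)\in E(\alpha^{-1}(Q_n),P_{f_n})\}$ with source $(n,S)$, range $(f_n,T)$ and the induced order ($F_0$ a single edge). Then $f=(\bigsqcup F_n,(f_n),\ge)$ is an ordered premorphism $\mathcal{P}(Y,\psi,y_0,(Q_n))\to\mathcal{P}(X,\varphi,x_0,(P_n))$, and $\mathcal{P}(\alpha)=[f]$.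
   Formalization: As stated the claim fails for every non-surjective α (some vertex emits no edge). Proved: P is a contravariant functor on surjective morphisms into OBD, and also on all morphisms if s^{-1}{v}≠∅ is dropped from the definition of ordered premorphism. *)

(* Defs.v *)
From HB Require Import structures.
From Corelib Require Setoid Morphisms.
From mathcomp Require Import all_boot finmap.
From mathcomp Require Import boolp classical_sets functions reals topology.

Set Implicit Arguments.
Unset Strict Implicit.
Unset Printing Implicit Defensive.

Local Open Scope classical_set_scope.

Record category := Category {
  obj :> Type;
  hom : obj -> obj -> Type;
  idm : forall x, hom x x;
  cmp : forall x y z, hom y z -> hom x y -> hom x z;
  cmp_idl : forall x y (f : hom x y), cmp (idm y) f = f;
  cmp_idr : forall x y (f : hom x y), cmp f (idm x) = f;
  cmp_assoc : forall w x y z (h : hom y z) (g : hom x y) (f : hom w x),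
    cmp h (cmp g f) = cmp (cmp h g) f }.

Arguments hom {c} x y.
Arguments idm {c} x.
Arguments cmp {c x y z} g f.

Definition contravariant_functor (C D : category) (F0 : C -> D)
    (F1 : forall x y : C, hom x y -> hom (F0 y) (F0 x)) : Prop :=
  (forall x : C, F1 x x (idm x) = idm (F0 x)) /\
  (forall (x y z : C) (g : hom y z) (f : hom x y),
     F1 x z (cmp g f) = cmp (F1 x y f) (F1 y z g)).

(* The sources and targets are arbitrary types, so that edge sets between
   different levels of a diagram can be compared; see [amb] below.  The order
   is raw data, its axioms are [ordered]. *)
Record edge_set (S T : Type) := EdgeSet {
  edge :> finType;
  src : edge -> S;
  rng : edge -> T;
  ele : rel edge }.

Arguments src {S T} e _.
Arguments rng {S T} e _.
Arguments ele {S T} e _ _.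

Definition ordered S T (F : edge_set S T) : Prop :=
  [/\ reflexive (ele F), antisymmetric (ele F), transitive (ele F)
    & forall e e' : F, (ele F e e' || ele F e' e) <-> rng F e = rng F e'].

Definition eiso S T (F G : edge_set S T) : Prop :=
  exists h : F -> G, [/\ bijective h,
    forall e, src G (h e) = src F e,
    forall e, rng G (h e) = rng F e
  & forall e e', ele G (h e) (h e') = ele F e e'].

Definition ecomp S (T : eqType) U (F : edge_set S T) (G : edge_set T U) :
    edge_set S U :=
  @EdgeSet S U {p : F * G | rng F p.1 == src G p.2}
    (fun p => src F (val p).1)
    (fun p => rng G (val p).2)
    (fun p q => ((val p).2 != (val q).2) && ele G (val p).2 (val q).2
             || ((val p).2 == (val q).2) && ele F (val p).1 (val q).1).

Definition eid (S : finType) : edge_set S S :=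
  @EdgeSet S S S id id (fun v w => v == w).

(* [bedge n] is the edge set usually called E_{n+1}, from level n to n+1. *)
Record obd_data := ObdData {
  vert : nat -> finType;
  bedge : forall n, edge_set (vert n) (vert n.+1) }.

Definition is_obd (B : obd_data) : Prop :=
  [/\ (forall n, (0 < #|vert B n|)%N) /\ #|vert B 0| = 1%N,
      forall n, (0 < #|bedge B n|)%N,
      forall n, ordered (bedge B n),
      forall n (v : vert B n), exists e, src (bedge B n) e = v
    & forall n (w : vert B n.+1), exists e, rng (bedge B n) e = w].

Record obd := Obd { obd_val :> obd_data; obdP : is_obd obd_val }.

(* The disjoint union of all the levels of B. *)
Definition vx (B : obd_data) : eqType := {n : nat & vert B n}.

Definition vtx (B : obd_data) n (v : vert B n) : vx B := Tagged (vert B) v.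

(* An edge set between two levels, seen between the whole vertex sets; this
   makes edge sets comparable without transporting along equations between
   level numbers. *)
Definition amb (B C : obd_data) n m (F : edge_set (vert B n) (vert C m)) :
    edge_set (vx B) (vx C) :=
  @EdgeSet (vx B) (vx C) F (fun e => vtx (src F e)) (fun e => vtx (rng F e))
    (ele F).

Fixpoint tele (B : obd_data) k d : edge_set (vx B) (vx B) :=
  if d is d'.+1 then ecomp (tele B k d') (amb (bedge B (k + d')))
  else amb (eid (vert B k)).

(* E_{k,l}, only used for k <= l. *)
Definition lev (B : obd_data) k l := tele B k (l - k).

Record premor_data (B C : obd_data) := PremorData {
  pidx : nat -> nat;
  pedge : forall n, edge_set (vert B n) (vert C (pidx n)) }.

(* With [total = true] these are the axioms of ordered premorphisms.  With
   [total = false] the vertices of the source diagram are not required to emit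
   an edge.  The weaker notion is there for the maps between dynamical systems
   that are not surjective: if y is not in the image of a : X -> Y, then a cell
   A around y, small enough, has an empty preimage, and the tower S of A is the
   source of no edge (S, T, k), since no cell of T is contained in the empty
   set. *)
Definition is_premor (total : bool) (B C : obd_data) (f : premor_data B C) :
    Prop :=
  [/\ [/\ pidx f 0 = 0%N, forall n, (pidx f n <= pidx f n.+1)%N
        & forall N, exists n, (N < pidx f n)%N],
      (forall n, (0 < #|pedge f n|)%N) /\ #|pedge f 0| = 1%N,
      forall n, ordered (pedge f n),
      (total -> forall n v, exists e, src (pedge f n) e = v) /\
      (forall n w, exists e, rng (pedge f n) e = w)
    & forall n, eiso (ecomp (amb (bedge B n)) (amb (pedge f n.+1)))
                     (ecomp (amb (pedge f n)) (lev C (pidx f n) (pidx f n.+1)))].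

Record premor (total : bool) (B C : obd_data) := Premor {
  premor_val :> premor_data B C;
  premorP : is_premor total premor_val }.

Definition pequiv total (B C : obd_data) (f g : premor total B C) : Prop :=
  exists n m : nat -> nat, [/\ (0 < n 0)%N,
    forall k, (n k < m k < n k.+1)%N,
    forall k, (pidx f (n k) < pidx g (m k) < pidx f (n k.+1))%N,
    forall k, eiso (ecomp (lev B (n k) (m k)) (amb (pedge g (m k))))
      (ecomp (amb (pedge f (n k))) (lev C (pidx f (n k)) (pidx g (m k))))
  & forall k, eiso (ecomp (lev B (m k) (n k.+1)) (amb (pedge f (n k.+1))))
      (ecomp (amb (pedge g (m k))) (lev C (pidx g (m k)) (pidx f (n k.+1))))].

Definition pid_data (B : obd_data) : premor_data B B :=
  @PremorData B B id (fun n => eid (vert B n)).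

(* [pcomp_data g f] is the composite gf. *)
Definition pcomp_data (B C D : obd_data) (g : premor_data C D)
    (f : premor_data B C) : premor_data B D :=
  @PremorData B D (fun n => pidx g (pidx f n))
    (fun n => ecomp (pedge f n) (pedge g (pidx f n))).

Lemma eiso_refl S T (F : edge_set S T) : eiso F F.
Proof. by exists id; split=> //; exists id. Qed.

Lemma eiso_sym S T (F G : edge_set S T) : eiso F G -> eiso G F.
Proof.
case=> h [[k hk kh] hs hr hl]; exists k; split.
- by exists h.
- by move=> e; rewrite -hs kh.
- by move=> e; rewrite -hr kh.
- by move=> e e'; rewrite -hl !kh.
Qed.

Lemma eiso_trans S T (F G H : edge_set S T) : eiso F G -> eiso G H -> eiso F H.
Proof.
case=> h [hb hs hr hl] [k [kb ks kr kl]]; exists (k \o h); split.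
- exact: bij_comp.
- by move=> e /=; rewrite ks hs.
- by move=> e /=; rewrite kr hr.
- by move=> e e' /=; rewrite kl hl.
Qed.

#[export] Instance eiso_equiv S T : RelationClasses.Equivalence (@eiso S T).
Proof.
split; [exact: eiso_refl|exact: eiso_sym|].
by move=> F G H; apply: eiso_trans.
Qed.

Section EdgeSets.
Variables (S : Type) (T : eqType) (U : Type).

Lemma ecomp_eiso (F F' : edge_set S T) (G G' : edge_set T U) :
  eiso F F' -> eiso G G' -> eiso (ecomp F G) (ecomp F' G').
Proof.
case=> h [[h' hh' h'h] hs hr hl] [k [[k' kk' k'k] ks kr kl]].
have u_ok (p : ecomp F G) : rng F' (h (val p).1) == src G' (k (val p).2).
  by rewrite hr ks; exact: (valP p).
have v_ok (p : ecomp F' G') : rng F (h' (val p).1) == src G (k' (val p).2).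
  by rewrite -hr -ks h'h k'k; exact: (valP p).
pose u (p : ecomp F G) : ecomp F' G' :=
  exist (fun q : F' * G' => rng F' q.1 == src G' q.2)
    (h (val p).1, k (val p).2) (u_ok p).
pose v (p : ecomp F' G') : ecomp F G :=
  exist (fun q : F * G => rng F q.1 == src G q.2)
    (h' (val p).1, k' (val p).2) (v_ok p).
exists u; split.
- exists v => [[[e g] p]|[[e g] p]]; apply: val_inj => /=.
  + by rewrite hh' kk'.
  + by rewrite h'h k'k.
- by move=> e /=.
- by move=> e /=.
- by move=> [[e g] p] [[e' g'] p'] /=; rewrite hl kl (can_eq kk').
Qed.

Lemma ecomp_ordered (F : edge_set S T) (G : edge_set T U) :
  ordered F -> ordered G -> ordered (ecomp F G).
Proof.
case=> rF aF tF cF [rG aG tG cG]; split.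
- by move=> [[e g] p] /=; rewrite eqxx rF.
- move=> [[e g] p] [[e' g'] p'] /=.
  have [gg /=|ne /=] := eqVneq g g'.
    by move=> /aF ee'; apply: val_inj; rewrite /= ee' gg.
  by rewrite !orbF => /aG gg'; rewrite gg' eqxx in ne.
- move=> [[e g] p] [[e' g'] p'] [[e2 g2] p2] /=.
  case: (eqVneq g' g) => [<-|n1] /=.
    by case: (eqVneq g' g2) => [<-|n2] /=; [exact: tF|rewrite !orbF].
  case: (eqVneq g g2) => [<-|n2] /=; rewrite ?orbF.
    by rewrite n1 (negbTE n1) /= orbF.
  case: (eqVneq g' g2) => [g'g2|n3] /= h1 h2.
    have gg : g' = g by apply: aG; rewrite h1 g'g2 h2.
    by rewrite gg eqxx in n1.
  by rewrite orbF; apply: tG h2.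
- move=> [[e g] p] [[e' g'] p'] /=; rewrite /= in p p' *.
  have [gg /=|ne /=] := eqVneq g g'.
    split=> [_|_]; first by rewrite gg.
    by apply/cF; rewrite (eqP p) (eqP p') gg.
  by rewrite !orbF; exact: cG.
Qed.

End EdgeSets.

#[export] Instance ecomp_proper S (T : eqType) U :
  Morphisms.Proper (Morphisms.respectful (@eiso S T)
    (Morphisms.respectful (@eiso T U) (@eiso S U))) (@ecomp S T U).
Proof. by move=> F F' FF' G G' GG'; exact: ecomp_eiso. Qed.

Lemma ecompA S (T U : eqType) W (F : edge_set S T) (G : edge_set T U)
    (H : edge_set U W) :
  eiso (ecomp F (ecomp G H)) (ecomp (ecomp F G) H).
Proof.
have ok1 (p : ecomp F (ecomp G H)) : rng F (val p).1 == src G (val (val p).2).1.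
  exact: (valP p).
have ok2 (p : ecomp F (ecomp G H)) :
    rng G (val (val p).2).1 == src H (val (val p).2).2.
  exact: (valP (val p).2).
pose u (p : ecomp F (ecomp G H)) : ecomp (ecomp F G) H :=
  exist (fun q : ecomp F G * H => rng (ecomp F G) q.1 == src H q.2)
   (exist (fun q : F * G => rng F q.1 == src G q.2)
      ((val p).1, (val (val p).2).1) (ok1 p), (val (val p).2).2) (ok2 p).
have ok3 (p : ecomp (ecomp F G) H) :
    rng F (val (val p).1).1 == src G (val (val p).1).2.
  exact: (valP (val p).1).
have ok4 (p : ecomp (ecomp F G) H) : rng G (val (val p).1).2 == src H (val p).2.
  exact: (valP p).
pose v (p : ecomp (ecomp F G) H) : ecomp F (ecomp G H) :=
  exist (fun q : F * ecomp G H => rng F q.1 == src (ecomp G H) q.2)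
   ((val (val p).1).1,
    exist (fun q : G * H => rng G q.1 == src H q.2)
      ((val (val p).1).2, (val p).2) (ok4 p)) (ok3 p).
exists u; split=> //.
- exists v.
  + case=> [[e [[g h] p]] q]; apply: val_inj => /=; congr pair.
    exact: val_inj.
  + case=> [[[[e g] p] h] q]; apply: val_inj => /=; congr pair.
    exact: val_inj.
- move=> [[e [[g h] p]] q] [[e' [[g' h'] p']] q'] /=.
  rewrite -!val_eqE /= !xpair_eqE.
  by case: (h == h'); case: (g == g'); case: (e == e') => //=;
    rewrite ?orbF ?andbF ?andbT ?orbT //=; case: (ele _ _ _).
Qed.

Lemma amb_eiso (B C : obd_data) n m (F F' : edge_set (vert B n) (vert C m)) :
  eiso F F' -> eiso (amb F) (amb F').
Proof.
by case=> h [hb hs hr hl]; exists h; split=> // e /=; rewrite ?hs ?hr.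
Qed.

Lemma vtx_inj (B : obd_data) n (v w : vert B n) : (vtx v == vtx w) = (v == w).
Proof. exact: eq_Tagged. Qed.

Lemma amb_comp (B C D : obd_data) n m p (F : edge_set (vert B n) (vert C m))
    (G : edge_set (vert C m) (vert D p)) :
  eiso (amb (ecomp F G)) (ecomp (amb F) (amb G)).
Proof.
have ok1 (q : ecomp F G) : vtx (rng F (val q).1) == vtx (src G (val q).2).
  by rewrite vtx_inj; exact: (valP q).
have ok2 (q : ecomp (amb F) (amb G)) : rng F (val q).1 == src G (val q).2.
  by rewrite -vtx_inj; exact: (valP q).
pose u (q : amb (ecomp F G)) : ecomp (amb F) (amb G) :=
  exist (fun q : amb F * amb G => rng (amb F) q.1 == src (amb G) q.2)
    (val q) (ok1 q).
pose v (q : ecomp (amb F) (amb G)) : amb (ecomp F G) :=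
  exist (fun q : F * G => rng F q.1 == src G q.2) (val q) (ok2 q).
exists u; split=> //; exists v => q; exact: val_inj.
Qed.

Lemma ecomp_idr A (B : obd_data) k (F : edge_set A (vx B)) :
  ordered F -> (forall e, exists v : vert B k, rng F e = vtx v) ->
  eiso (ecomp F (amb (eid (vert B k)))) F.
Proof.
case=> _ _ _ cF Fk; have [h hP] := choice Fk.
have ok (e : F) : rng F e == src (amb (eid (vert B k))) (h e).
  by rewrite hP.
pose u (e : F) : ecomp F (amb (eid (vert B k))) :=
  exist (fun p : F * amb (eid (vert B k)) =>
    rng F p.1 == src (amb (eid (vert B k))) p.2) (e, h e) (ok e).
exists (fun p => (val p).1); split=> //.
- exists u => //.
  move=> [[e v] /= p]; apply: val_inj => /=; congr pair.
  by apply/eqP; rewrite -vtx_inj -hP.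
- by move=> [[e v] /= p]; apply/eqP.
- move=> [[e v] /= p] [[e' v'] /= p'].
  have [//|/= ne] := eqVneq v v'.
  apply/negbTE/negP => ee'; move: ne; rewrite -vtx_inj -(eqP p) -(eqP p').
  by move/eqP; apply; apply/cF; rewrite ee'.
Qed.

Lemma ecomp_idl (B : obd_data) k A (F : edge_set (vx B) A) :
  ordered F -> (forall e, exists v : vert B k, src F e = vtx v) ->
  eiso (ecomp (amb (eid (vert B k))) F) F.
Proof.
case=> rF _ _ _ Fk; have [h hP] := choice Fk.
have ok (e : F) : rng (amb (eid (vert B k))) (h e) == src F e.
  by rewrite hP.
pose u (e : F) : ecomp (amb (eid (vert B k))) F :=
  exist (fun p : amb (eid (vert B k)) * F =>
    rng (amb (eid (vert B k))) p.1 == src F p.2) (h e, e) (ok e).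
exists (fun p => (val p).2); split=> //.
- exists u => //.
  move=> [[v e] /= p]; apply: val_inj => /=; congr pair.
  by apply/eqP; rewrite -vtx_inj -hP eq_sym.
- by move=> [[v e] /= p]; rewrite -(eqP p).
- move=> [[v e] /= p] [[v' e'] /= p'].
  have [ee'|/= ne] := eqVneq e e'; last by rewrite orbF.
  by rewrite /= ee' rF -vtx_inj (eqP p) (eqP p') ee' eqxx.
Qed.

Lemma amb_ordered (B C : obd_data) n m (F : edge_set (vert B n) (vert C m)) :
  ordered F -> ordered (amb F).
Proof.
case=> rF aF tF cF; split=> // e e'; split.
  by move/cF => /= ->.
by move=> /= /eqP; rewrite vtx_inj => /eqP /cF.
Qed.

Lemma eid_ordered (S : finType) : ordered (eid S).
Proof.
split.
- by move=> e /=.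
- by move=> e e' /andP[/eqP].
- by move=> x y z /eqP -> .
- move=> e e' /=; split=> [/orP[] /eqP -> //|->].
  by rewrite eqxx.
Qed.

Section Levels.
Variable B : obd.

Lemma bedge_ordered n : ordered (bedge B n).
Proof. by case: (obdP B). Qed.

Lemma tele_ordered k d : ordered (tele B k d).
Proof.
elim: d => [|d IH]; first by apply: amb_ordered; exact: eid_ordered.
by apply: ecomp_ordered => //; apply: amb_ordered; exact: bedge_ordered.
Qed.

Lemma tele_src k d (e : tele B k d) : exists v : vert B k, src _ e = vtx v.
Proof.
elim: d e => [|d IH] e; first by exists e.
by have [v vE] := IH (val e).1; exists v.
Qed.

Lemma tele_rng k d (e : tele B k d) :
  exists v : vert B (k + d), rng _ e = vtx v.
Proof.
case: d e => [|d] e; first by rewrite addn0; exists e.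
by rewrite addnS; exists (rng (bedge B (k + d)) (val e).2).
Qed.

Lemma tele_cat k d d' :
  eiso (ecomp (tele B k d) (tele B (k + d) d')) (tele B k (d + d')).
Proof.
elim: d' => [|d' IH].
  rewrite addn0; apply: ecomp_idr; [exact: tele_ordered|exact: tele_rng].
rewrite addnS /= -addnA ecompA.
by apply: ecomp_eiso => //; exact: eiso_refl.
Qed.

Lemma lev_cat k l m : (k <= l)%N -> (l <= m)%N ->
  eiso (ecomp (lev B k l) (lev B l m)) (lev B k m).
Proof.
move=> kl lm; rewrite /lev -{2}(subnKC kl).
have -> : (m - k = (l - k) + (m - l))%N.
  by rewrite addnC addnBA // subnK.
exact: tele_cat.
Qed.

Lemma lev_bedge k : eiso (amb (bedge B k)) (lev B k k.+1).
Proof.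
rewrite /lev subSnn /= addn0; apply/eiso_sym/ecomp_idl.
  by apply: amb_ordered; exact: bedge_ordered.
by move=> e; exists (src (bedge B k) e).
Qed.

Lemma lev_ordered k l : ordered (lev B k l).
Proof. exact: tele_ordered. Qed.

Lemma lev_idr A k (F : edge_set A (vx B)) : ordered F ->
  (forall e, exists v : vert B k, rng F e = vtx v) ->
  eiso (ecomp F (lev B k k)) F.
Proof. by rewrite /lev subnn; exact: ecomp_idr. Qed.

Lemma lev_idl A k (F : edge_set (vx B) A) : ordered F ->
  (forall e, exists v : vert B k, src F e = vtx v) ->
  eiso (ecomp (lev B k k) F) F.
Proof. by rewrite /lev subnn; exact: ecomp_idl. Qed.

End Levels.

Arguments lev_cat {B k l m}.
Arguments lev_bedge {B}.

Section Premorphisms.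
Variable total : bool.

Lemma pidx_mono (B C : obd_data) (f : premor total B C) n m :
  (n <= m)%N -> (pidx f n <= pidx f m)%N.
Proof.
case: (premorP f) => [[_ mf _]] _ _ _ _.
by apply: (@homo_leq _ (pidx f) leq) => //; exact: leq_trans.
Qed.

Lemma pidx_large (B C : obd_data) (f : premor total B C) n k :
  exists m, (n < m)%N && (k < pidx f m)%N.
Proof.
case: (premorP f) => [[_ _ uf]] _ _ _ _.
have [m hm] := uf k; exists (maxn n.+1 m); rewrite leq_maxl /=.
by apply: leq_trans hm _; apply: pidx_mono; exact: leq_maxr.
Qed.

Lemma pedge_ordered (B C : obd_data) (f : premor total B C) n :
  ordered (pedge f n).
Proof. by case: (premorP f). Qed.

Lemma premor_square (B C : obd) (f : premor total B C) n m : (n <= m)%N ->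
  eiso (ecomp (lev B n m) (amb (pedge f m)))
       (ecomp (amb (pedge f n)) (lev C (pidx f n) (pidx f m))).
Proof.
move=> nm; rewrite -(subnKC nm); elim: (m - n)%N => [|d IH].
  rewrite addn0; apply: (eiso_trans (G := amb (pedge f n))).
    apply: lev_idl; first by apply: amb_ordered; exact: pedge_ordered.
    by move=> e; exists (src (pedge f n) e).
  apply/eiso_sym/lev_idr; first by apply: amb_ordered; exact: pedge_ordered.
  by move=> e; exists (rng (pedge f n) e).
have sq : eiso _ _ := let: And5 _ _ _ _ h := premorP f in h (n + d)%N.
rewrite addnS.
rewrite -(lev_cat (leq_addr d n) (leqnSn _)) -lev_bedge -ecompA sq ecompA IH.
rewrite -ecompA lev_cat; first exact: eiso_refl.
- by apply: pidx_mono; exact: leq_addr.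
- by apply: pidx_mono.
Qed.

Definition stable (B C : obd_data) (f g : premor_data B C) :=
  forall n, exists k, [/\ (pidx f n <= k)%N, (pidx g n <= k)%N
    & eiso (ecomp (amb (pedge f n)) (lev C (pidx f n) k))
           (ecomp (amb (pedge g n)) (lev C (pidx g n) k))].

Lemma stable_sym (B C : obd_data) (f g : premor_data B C) :
  stable f g -> stable g f.
Proof.
by move=> fg n; have [k [? ? ?]] := fg n; exists k; split=> //; exact: eiso_sym.
Qed.

Lemma stable_at (B C : obd) (f g : premor_data B C) : stable f g ->
  forall n, exists k0, forall k, (k0 <= k)%N -> [/\ (pidx f n <= k)%N,
    (pidx g n <= k)%N & eiso (ecomp (amb (pedge f n)) (lev C (pidx f n) k))
           (ecomp (amb (pedge g n)) (lev C (pidx g n) k))].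
Proof.
move=> fg n; have [k0 [fk gk iso]] := fg n; exists k0 => k k0k; split.
- exact: leq_trans fk k0k.
- exact: leq_trans gk k0k.
- by rewrite -(lev_cat fk k0k) -(lev_cat gk k0k) !ecompA iso; exact: eiso_refl.
Qed.

Lemma stable_trans (B C : obd) (f g h : premor_data B C) :
  stable f g -> stable g h -> stable f h.
Proof.
move=> /stable_at fg /stable_at gh n.
have [k1 /(_ (maxn k1 _)) fgk] := fg n; have [k2 ghk] := gh n.
have [|? ? e1] := fgk k2; first exact: leq_maxl.
have [|? ? e2] := ghk (maxn k1 k2); first exact: leq_maxr.
by exists (maxn k1 k2); split=> //; exact: eiso_trans e1 e2.
Qed.

Lemma stable_step (B C : obd) (f g : premor total B C) : stable f g ->
  forall n, exists m, [/\ (n < m)%N, (pidx f n < pidx g m)%N &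
    eiso (ecomp (lev B n m) (amb (pedge g m)))
      (ecomp (amb (pedge f n)) (lev C (pidx f n) (pidx g m)))].
Proof.
move=> /stable_at fg n; have [k0 hk] := fg n.
have [m /andP[nm lm]] := pidx_large g n (maxn k0 (pidx f n)).
move: lm; rewrite gtn_max => /andP[k0m fm]; exists m; split=> //.
have [_ _ iso] := hk _ (ltnW k0m).
by rewrite iso premor_square; [exact: eiso_refl|exact: ltnW].
Qed.

Lemma pequiv_stable (B C : obd) (f g : premor total B C) :
  pequiv f g <-> stable f g.
Proof.
split=> [[n [m [n0 nm fg e1 e2]]] p|fg].
  have nk k : (k < n k)%N.
    elim: k => [|k IH]; first exact: n0.
    have /andP[h1 h2] := nm k; apply: leq_ltn_trans IH _.
    exact: ltn_trans h1 h2.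
  have pn : (p <= n p)%N by apply: ltnW.
  have /andP[nmp _] := nm p; have /andP[fgp _] := fg p.
  have pm : (p <= m p)%N by apply: leq_trans pn _; exact: ltnW.
  exists (pidx g (m p)); split.
  - by apply: leq_trans (ltnW fgp); exact: pidx_mono.
  - exact: pidx_mono.
  - rewrite -(premor_square g pm).
    rewrite -(lev_cat (pidx_mono f pn) (ltnW fgp)) ecompA -premor_square //.
    by rewrite -ecompA -e1 ecompA lev_cat //; [exact: eiso_refl|exact: ltnW].
have [a aP] := choice (stable_step fg).
have [b bP] := choice (stable_step (stable_sym fg)).
pose n k := iter k (b \o a) 1%N.
exists n, (a \o n); split=> // k.
- by have [-> _ _] := aP (n k); have [-> _ _] := bP (a (n k)).
- by have [_ -> _] := aP (n k); have [_ -> _] := bP (a (n k)).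
- by have [_ _] := aP (n k).
- by have [_ _] := bP (a (n k)).
Qed.

Lemma pequiv_refl (B C : obd) (f : premor total B C) : pequiv f f.
Proof.
by apply/pequiv_stable => n; exists (pidx f n); split=> //; exact: eiso_refl.
Qed.

Lemma pequiv_sym (B C : obd) (f g : premor total B C) :
  pequiv f g -> pequiv g f.
Proof. by move=> /pequiv_stable/stable_sym fg; apply/pequiv_stable. Qed.

Lemma pequiv_trans (B C : obd) (f g h : premor total B C) :
  pequiv f g -> pequiv g h -> pequiv f h.
Proof.
move=> /pequiv_stable fg /pequiv_stable gh.
by apply/pequiv_stable; exact: stable_trans fg gh.
Qed.

Lemma pid_is_premor (B : obd) : is_premor total (pid_data B).
Proof.
case: (obdP B) => [[V0 V1] _ _ _ _]; split=> /=.
- by split=> // N; exists N.+1.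
- by split=> //; rewrite -V1.
- by move=> n; exact: eid_ordered.
- by split=> [_|] n v; exists v.
- move=> n; rewrite -lev_bedge.
  apply: (eiso_trans (G := amb (bedge B n))).
    apply: ecomp_idr; first by apply: amb_ordered; exact: bedge_ordered.
    by move=> e; exists (rng (bedge B n) e).
  apply/eiso_sym/ecomp_idl; first by apply: amb_ordered; exact: bedge_ordered.
  by move=> e; exists (src (bedge B n) e).
Qed.

Definition pid (B : obd) : premor total B B := Premor (pid_is_premor B).

Lemma pcomp_is_premor (B C D : obd) (g : premor total C D)
  (f : premor total B C) : is_premor total (pcomp_data g f).
Proof.
case: (premorP f) => [[f0 _ _] [cf cf0] of_ [sf rf] _].
case: (premorP g) => [[g0 _ ug] [cg cg0] og [sg rg] _].
split=> /=.
- split; first by rewrite f0.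
  + by move=> n; apply: pidx_mono; apply: pidx_mono.
  + move=> N; have [m hm] := ug N.
    have [n /andP[_ hn]] := pidx_large f 0 m; exists n.
    by apply: leq_trans hm _; apply: pidx_mono; exact: ltnW.
- split=> [n|].
    have /card_gt0P[e _] := cg (pidx f n).
    have [e' e'P] := rf n (src _ e).
    apply/card_gt0P; rewrite /= in e e' e'P *.
    have p : rng (pedge f n) (e', e).1 == src (pedge g (pidx f n)) (e', e).2.
      by rewrite /= e'P.
    by exists (exist (fun q : pedge f n * pedge g (pidx f n) =>
      rng (pedge f n) q.1 == src (pedge g (pidx f n)) q.2) (e', e) p).
  have cg0' : #|pedge g (pidx f 0)| = 1%N by rewrite f0.
  have C0 : #|vert C (pidx f 0)| = 1%N by rewrite f0; case: (obdP C) => [[]].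
  have /fintype1P[v vP] : #|vert C (pidx f 0)| == 1%N by rewrite C0.
  rewrite card_sig -[RHS](muln1 1%N) -{1}cf0 -cg0' -card_prod.
  by apply: eq_card => q; rewrite !inE (vP (rng _ _)) (vP (src _ _)) eqxx.
- by move=> n; apply: ecomp_ordered; [exact: of_|exact: og].
- split=> [tt n v|n w].
    have [e eE] := sf tt n v; have [e' e'E] := sg tt (pidx f n) (rng _ e).
    have p : rng (pedge f n) (e, e').1 == src (pedge g (pidx f n)) (e, e').2.
      by rewrite /= e'E.
    by exists (exist (fun q : pedge f n * pedge g (pidx f n) =>
      rng (pedge f n) q.1 == src (pedge g (pidx f n)) q.2) (e, e') p).
  have [e' e'E] := rg (pidx f n) w; have [e eE] := rf n (src _ e').
  have p : rng (pedge f n) (e, e').1 == src (pedge g (pidx f n)) (e, e').2.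
    by rewrite /= eE.
  by exists (exist (fun q : pedge f n * pedge g (pidx f n) =>
    rng (pedge f n) q.1 == src (pedge g (pidx f n)) q.2) (e, e') p).
- move=> n; rewrite !amb_comp ecompA.
  rewrite lev_bedge premor_square // -!ecompA premor_square; last first.
    exact: pidx_mono.
  exact: eiso_refl.
Qed.

Definition pcomp (B C D : obd) (g : premor total C D) (f : premor total B C) :
  premor total B D := Premor (pcomp_is_premor g f).

Lemma pcomp_pequiv (B C D : obd) (g g' : premor total C D)
    (f f' : premor total B C) :
  pequiv f f' -> pequiv g g' -> pequiv (pcomp g f) (pcomp g' f').
Proof.
move=> /pequiv_stable/stable_at ff /pequiv_stable/stable_at gg.
apply/pequiv_stable => n /=.
have [k0 /(_ k0 (leqnn _)) [fk fk' fe]] := ff n.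
have [l0 lP] := gg (pidx f' n).
pose l := maxn l0 (maxn (pidx g k0) (pidx g' k0)).
have [_ _ ge] := lP l (leq_maxl _ _).
have gl : (pidx g k0 <= l)%N by rewrite /l !leq_max leqnn !orbT.
have gl' : (pidx g' k0 <= l)%N by rewrite /l !leq_max leqnn !orbT.
exists l; split.
- by apply: leq_trans gl; exact: pidx_mono.
- by apply: leq_trans gl'; exact: pidx_mono.
- rewrite !amb_comp -!ecompA -ge.
  rewrite -(lev_cat (pidx_mono g fk) gl) -(lev_cat (pidx_mono g fk') gl).
  rewrite !(ecompA _ (lev D _ _)) -!premor_square // !ecompA fe.
  exact: eiso_refl.
Qed.

Lemma pcomp_idl (B C : obd) (f : premor total B C) :
  pequiv (pcomp (pid C) f) f.
Proof.
apply/pequiv_stable => n; exists (pidx f n); split=> //.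
apply: ecomp_eiso; last exact: eiso_refl.
rewrite amb_comp; apply: ecomp_idr.
  by apply: amb_ordered; exact: pedge_ordered.
by move=> e; exists (rng (pedge f n) e).
Qed.

Lemma pcomp_idr (B C : obd) (f : premor total B C) :
  pequiv (pcomp f (pid B)) f.
Proof.
apply/pequiv_stable => n; exists (pidx f n); split=> //.
apply: ecomp_eiso; last exact: eiso_refl.
rewrite amb_comp; apply: ecomp_idl.
  by apply: amb_ordered; exact: pedge_ordered.
by move=> e; exists (src (pedge f n) e).
Qed.

Lemma pcompA (A B C D : obd) (h : premor total C D) (g : premor total B C)
    (f : premor total A B) :
  pequiv (pcomp h (pcomp g f)) (pcomp (pcomp h g) f).
Proof.
apply/pequiv_stable => n; exists (pidx h (pidx g (pidx f n))); split=> //.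
apply: ecomp_eiso; last exact: eiso_refl.
by apply: amb_eiso; apply: eiso_sym; exact: ecompA.
Qed.

End Premorphisms.

Definition pclass total (B C : obd) (f : premor total B C) :
  premor total B C -> Prop := fun g => pequiv f g.

Definition obd_hom (total : bool) (B C : obd) : Type :=
  {c : premor total B C -> Prop | exists f, c = pclass f}.

Definition mor total (B C : obd) (f : premor total B C) : obd_hom total B C :=
  exist _ (pclass f) (ex_intro _ f erefl).

Definition rep total (B C : obd) (c : obd_hom total B C) : premor total B C :=
  projT1 (cid (proj2_sig c)).

Lemma mor_eq total (B C : obd) (f g : premor total B C) :
  mor f = mor g <-> pequiv f g.
Proof.
split=> [[fg]|fg].
  have : pclass g g by exact: pequiv_refl.
  by rewrite -fg.
apply: eq_exist; apply: funext => h; apply: propext; split; rewrite /pclass.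
  by apply: pequiv_trans; exact: pequiv_sym.
exact: pequiv_trans.
Qed.

Lemma mor_rep total (B C : obd) (c : obd_hom total B C) : mor (rep c) = c.
Proof.
rewrite /rep; case: cid => f /=; case: c => c hc /= cE.
exact: eq_exist.
Qed.

Lemma rep_mor total (B C : obd) (f : premor total B C) :
  pequiv (rep (mor f)) f.
Proof. by apply/mor_eq; exact: mor_rep. Qed.

Definition obd_id total (B : obd) : obd_hom total B B := mor (pid total B).

Definition obd_cmp total (B C D : obd) (g : obd_hom total C D)
  (f : obd_hom total B C) : obd_hom total B D := mor (pcomp (rep g) (rep f)).

Lemma obd_cmpE total (B C D : obd) (g : premor total C D)
    (f : premor total B C) :
  obd_cmp (mor g) (mor f) = mor (pcomp g f).
Proof. by apply/mor_eq/pcomp_pequiv; exact: rep_mor. Qed.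

Lemma obd_cmp_idl total (B C : obd) (f : obd_hom total B C) :
  obd_cmp (obd_id total C) f = f.
Proof. by rewrite -(mor_rep f) obd_cmpE; apply/mor_eq/pcomp_idl. Qed.

Lemma obd_cmp_idr total (B C : obd) (f : obd_hom total B C) :
  obd_cmp f (obd_id total B) = f.
Proof. by rewrite -(mor_rep f) obd_cmpE; apply/mor_eq/pcomp_idr. Qed.

Lemma obd_cmpA total (A B C D : obd) (h : obd_hom total C D)
    (g : obd_hom total B C) (f : obd_hom total A B) :
  obd_cmp h (obd_cmp g f) = obd_cmp (obd_cmp h g) f.
Proof.
rewrite -(mor_rep f) -(mor_rep g) -(mor_rep h) !obd_cmpE.
by apply/mor_eq/pcompA.
Qed.

Definition OBD (total : bool) : category :=
  Category (@obd_cmp_idl total) (@obd_cmp_idr total) (@obd_cmpA total).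

Definition homeomorphism (X : topologicalType) (phi : X -> X) : Prop :=
  continuous phi /\
  exists psi : X -> X, [/\ continuous psi, cancel phi psi & cancel psi phi].

Definition metrizable (R : realType) (X : topologicalType) : Prop :=
  exists (M : metricType R) (h : X -> M) (k : M -> X),
    [/\ continuous h, continuous k, cancel h k & cancel k h].

Definition closed_invariant (X : topologicalType) (phi : X -> X) (M : set X) :
    Prop :=
  [/\ closed M, M !=set0 & phi @` M = M].

Definition minimal_set (X : topologicalType) (phi : X -> X) (M : set X) : Prop :=
  closed_invariant phi M /\
  forall N, closed_invariant phi N -> N `<=` M -> N = M.

Definition essentially_minimal (R : realType) (X : topologicalType)
    (phi : X -> X) (x0 : X) : Prop :=
  [/\ [/\ metrizable R X, compact [set: X] & totally_disconnected [set: X]],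
      homeomorphism phi
    & exists M, [/\ minimal_set phi M,
        forall N, minimal_set phi N -> N = M & M x0]].

(* A tower (Z_1, ..., Z_m) is the sequence of its levels, numbered from 0.
   The tower structure of a partition is part of the data, since in general
   the levels alone do not determine it. *)
Definition towers (X : Type) := {fset (seq (set X))}.

Definition cells (X : Type) (P : towers X) : set (set X) :=
  [set A | exists2 S, S \in P & A \in S].

Definition top (X : Type) (P : towers X) : set X :=
  [set x | exists2 S, S \in P & last set0 S x].

Definition bottom (X : Type) (P : towers X) : set X :=
  [set x | exists2 S, S \in P & head set0 S x].

Definition refines (X : Type) (P Q : towers X) : Prop :=
  forall B, cells Q B -> exists2 A, cells P A & B `<=` A.

Definition kr_partition (X : topologicalType) (phi : X -> X) (x0 : X)
    (P : towers X) : Prop :=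
  [/\ [/\ forall S, S \in P -> (0 < size S)%N,
          forall A, cells P A -> clopen A /\ A !=set0,
          forall x, exists2 A, cells P A & A x
        & forall S T i j, S \in P -> T \in P ->
            (i < size S)%N -> (j < size T)%N ->
            nth set0 S i `&` nth set0 T j !=set0 -> S = T /\ i = j],
      forall S i, S \in P -> (i.+1 < size S)%N ->
        phi @` nth set0 S i = nth set0 S i.+1,
      top P x0
    & phi @` top P = bottom P].

Definition kr_system (X : topologicalType) (phi : X -> X) (x0 : X)
    (P : nat -> towers X) : Prop :=
  [/\ (forall n, kr_partition phi x0 (P n)) /\ P 0 = [fset [:: setT]]%fset,
      forall n, refines (P n) (P n.+1),
      forall n, (0 < n)%N -> top (P n.+1) `<=` top (P n),
      \bigcap_(n in [set n | (0 < n)%N]) top (P n) = [set x0]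
    & basis (\bigcup_n cells (P n))].

Record sds (R : realType) := Sds {
  space : topologicalType;
  act : space -> space;
  base : space;
  part : nat -> towers space;
  sds_em : essentially_minimal R act base;
  sds_kr : kr_system act base part }.

(* All morphisms for [onto = false], the surjective ones for [onto = true];
   see [is_premor]. *)
Definition is_sds_mor (onto : bool) (R : realType) (X Y : sds R)
    (a : space X -> space Y) : Prop :=
  [/\ continuous a, a \o @act R X = @act R Y \o a, a (base X) = base Y
    & onto -> set_surj setT setT a].

Definition sds_hom (onto : bool) (R : realType) (X Y : sds R) : Type :=
  {a : space X -> space Y | is_sds_mor onto a}.

Definition sds_fun onto R (X Y : sds R) (a : sds_hom onto X Y) :
  space X -> space Y := proj1_sig a.

Coercion sds_fun : sds_hom >-> Funclass.

Lemma sds_id_mor onto R (X : sds R) : is_sds_mor onto (@id (space X)).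
Proof. by split=> // [x|_ x _]; [exact: cvg_id|exists x]. Qed.

Lemma sds_cmp_mor onto R (X Y Z : sds R) (b : sds_hom onto Y Z)
    (a : sds_hom onto X Y) : is_sds_mor onto (b \o a).
Proof.
case: a => a [ca ea ba sa]; case: b => b [cb eb bb sb]; split=> /=.
- by move=> x; apply: continuous_comp; [exact: ca|exact: cb].
- by rewrite -compA ea compA eb -compA.
- by rewrite ba bb.
- move=> tt z _; have [y _ <-] := sb tt z I.
  by have [x _ <-] := sa tt y I; exists x.
Qed.

Definition sds_id onto R (X : sds R) : sds_hom onto X X :=
  exist _ _ (sds_id_mor onto X).

Definition sds_cmp onto R (X Y Z : sds R) (b : sds_hom onto Y Z)
  (a : sds_hom onto X Y) : sds_hom onto X Z := exist _ _ (sds_cmp_mor b a).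

Lemma sds_cmp_idl onto R (X Y : sds R) (a : sds_hom onto X Y) :
  sds_cmp (sds_id onto Y) a = a.
Proof. by case: a => a aP; exact: eq_exist. Qed.

Lemma sds_cmp_idr onto R (X Y : sds R) (a : sds_hom onto X Y) :
  sds_cmp a (sds_id onto X) = a.
Proof. by case: a => a aP; exact: eq_exist. Qed.

Lemma sds_cmpA onto R (W X Y Z : sds R) (c : sds_hom onto Y Z)
    (b : sds_hom onto X Y) (a : sds_hom onto W X) :
  sds_cmp c (sds_cmp b a) = sds_cmp (sds_cmp c b) a.
Proof. exact: eq_exist. Qed.

Definition SDS (onto : bool) (R : realType) : category :=
  Category (@sds_cmp_idl onto R) (@sds_cmp_idr onto R) (@sds_cmpA onto R).

Definition occurs (X : Type) (S T : seq (set X)) (k : nat) : Prop :=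
  (k + size S <= size T)%N /\
  forall j, (j < size S)%N -> nth set0 T (k + j) `<=` nth set0 S j.

(* Triples (S, T, k) where S is a tower of Q and T a tower of P such that the
   sequence [pull S] occurs in T at k. *)
Definition tower_edges (X Y : Type) (pull : seq (set Y) -> seq (set X))
    (Q : towers Y) (P : towers X) : edge_set Q P :=
  @EdgeSet Q P
    {e : Q * {T : P & 'I_(size (val T)).+1} |
      `[< occurs (pull (val e.1)) (val (tag e.2)) (tagged e.2) >]}
    (fun e => (val e).1)
    (fun e => tag (val e).2)
    (fun e e' => (tag (val e).2 == tag (val e').2) &&
      (tagged (val e).2 <= tagged (val e').2)%N).

Definition kr_diagram (R : realType) (X : sds R) : obd_data :=
  @ObdData (fun n => part X n : finType)
    (fun n => tower_edges id (part X n) (part X n.+1)).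

Definition pull_tower (X Y : Type) (a : X -> Y) (S : seq (set Y)) :
  seq (set X) := [seq a @^-1` Z | Z <- S].

(* Some of the sequences may consist of empty sets if a is not surjective. *)
Definition pull_towers (X Y : Type) (a : X -> Y) (Q : towers Y) : towers X :=
  [fset pull_tower a S | S in Q]%fset.

Definition adapted (R : realType) (X Y : sds R) (a : space X -> space Y)
    (f : nat -> nat) : Prop :=
  [/\ f 0 = 0%N, forall n, (f n <= f n.+1)%N & forall N, exists n, (N < f n)%N] /\
  forall n, refines (pull_towers a (part Y n)) (part X (f n)) /\
    top (part X (f n)) `<=` top (pull_towers a (part Y n)).

Definition kr_premor (R : realType) (X Y : sds R) (a : space X -> space Y)
    (f : nat -> nat) : premor_data (kr_diagram Y) (kr_diagram X) :=
  @PremorData (kr_diagram Y) (kr_diagram X) f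
    (fun n => tower_edges (pull_tower a) (part Y n) (part X (f n))).

(* Main.v *)
Require Import Defs.
From mathcomp Require Import all_boot finmap.
From mathcomp Require Import boolp classical_sets reals topology.

Set Implicit Arguments.
Unset Strict Implicit.
Unset Printing Implicit Defensive.

Local Open Scope classical_set_scope.

(** Everything rests on one fact about Kakutani-Rokhlin partitions.  Let
    a : X -> Y commute with the dynamics, let Q be a partition of Y and P one
    of X that refines the inverse image of Q and whose top lies in the inverse
    image of the top of Q.  Climbing a tower T of P, the image in Y climbs the
    towers of Q, and it can only pass from one tower of Q to another from a top
    level to a bottom level.  It starts at a bottom level since the bottoms are
    the images of the tops, and it ends at a top level.  So T is cut into
    consecutive blocks, each of which runs through one tower of Q from bottom
    to top: these blocks are the edges with range T, and every level of T lies
    in exactly one of them ([kr_tiled] for existence, [occurs_uniq] for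
    uniqueness).

    Cutting twice gives the composition law [tower_edges_comp]: for towers R,
    Q, P in Z, Y, X and maps b : Y -> Z, a : X -> Y, the composite of the edge
    sets of (b, R, Q) and (a, Q, P) is the edge set of (b o a, R, P).  A pair
    of edges at heights k and l goes to the edge at height l + k; an edge at
    height m comes from the unique block of Q that contains the level m.  The
    lexicographic order is the order of the heights because distinct blocks
    do not overlap.

    The rest is formal.  The composition law with b = a = id identifies the
    telescoped edge sets of the diagram with edge sets of two partitions of the
    system ([kr_lev]), and then says that the edge set of (a, Q_n, P_(f n)),
    followed by the diagram up to level k, is the edge set of (a, Q_n, P_k),
    which does not involve f ([kr_edges_lev]).  Since premorphisms are
    equivalent as soon as they agree at each level after telescoping far
    enough, this gives independence of f, the identity law and, with one more
    use of the composition law, compatibility with composition.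

    Sequences f exist by compactness ([adapted_eventually]): the clopen inverse
    images of the cells of Q_n are eventually unions of cells of P_m because
    these cells form a basis, and the tops of the P_m shrink to the base point,
    which lies in the open inverse image of the top of Q_n. *)

(** * Occurrences of towers in towers *)

(** The part of the axioms of a Kakutani-Rokhlin partition that involves
    neither the topology nor the dynamics; it makes the height and the tower of
    a point well defined, without asking that the towers cover the space. *)
Definition separated (X : Type) (P : towers X) : Prop :=
  [/\ forall S, S \in P -> (0 < size S)%N,
      forall S i, S \in P -> (i < size S)%N -> nth set0 S i !=set0
    & forall S T i j, S \in P -> T \in P -> (i < size S)%N -> (j < size T)%N ->
        nth set0 S i `&` nth set0 T j !=set0 -> S = T /\ i = j].

Lemma nth_pull X Y (a : X -> Y) S i :
  nth set0 (pull_tower a S) i = a @^-1` nth set0 S i.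
Proof.
have [iS|Si] := ltnP i (size S); first exact: (nth_map set0).
by rewrite !nth_default ?preimage_set0 ?size_map.
Qed.

Lemma occurs_pullE X Y (a : X -> Y) S (T : seq (set X)) k :
  occurs (pull_tower a S) T k <-> (k + size S <= size T)%N /\
    forall j, (j < size S)%N -> nth set0 T (k + j) `<=` a @^-1` nth set0 S j.
Proof.
rewrite /occurs size_map; split=> -[kT h]; split=> // j jS.
  by rewrite -nth_pull; exact: h.
by rewrite nth_pull; exact: h.
Qed.

Section Edges.
Variables (X Y : Type) (a : X -> Y) (Q : towers Y) (P : towers X).
Let E := tower_edges (pull_tower a) Q P.

(** The height of an edge: the level of its range at which its source starts. *)
Definition pos (e : tower_edges (pull_tower a) Q P) : nat := tagged (val e).2.

Lemma pos_occurs (e : E) :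
  occurs (pull_tower a (val (src E e))) (val (rng E e)) (pos e).
Proof. by case: e => [[S [T k]] /= p]; exact/asboolP. Qed.

Lemma eleE (e e' : E) :
  ele E e e' = (rng E e == rng E e') && (pos e <= pos e')%N.
Proof. by []. Qed.

Lemma tower_edge_inj (e e' : E) :
  src E e = src E e' -> rng E e = rng E e' -> pos e = pos e' -> e = e'.
Proof.
case: e e' => [[S [T k]] p] [[S' [T' k']] p']; rewrite /pos /= => SS TT.
by case: T' / TT k' p' => k' p' /val_inj kk; apply: val_inj; rewrite /= SS kk.
Qed.

Lemma tower_edge_ex (S : Q) (T : P) k :
  occurs (pull_tower a (val S)) (val T) k ->
  exists e : E, [/\ src E e = S, rng E e = T & pos e = k].
Proof.
move=> o; have kT : (k < (size (val T)).+1)%N.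
  by case: o => + _; apply: leq_trans; exact: leq_addr.
pose t : {T : P & 'I_(size (val T)).+1} := Tagged _ (Ordinal kT).
have p : `[< occurs (pull_tower a (val (S, t).1)) (val (tag (S, t).2))
    (tagged (S, t).2) >].
  exact/asboolP.
by exists (exist _ (S, t) p).
Qed.

Hypotheses (sepQ : separated Q) (sepP : separated P).

(** The level j of T has a point, and its image in Y lies at height j - k of S
    and at height j - k' of S'; the cells of Q are disjoint. *)
Lemma occurs_uniq S S' T k k' j : S \in Q -> S' \in Q -> T \in P ->
  occurs (pull_tower a S) T k -> occurs (pull_tower a S') T k' ->
  (k <= j < k + size S)%N -> (k' <= j < k' + size S')%N -> S = S' /\ k = k'.
Proof.
case: sepQ sepP => _ _ dQ [_ nP _] SQ SQ' TP.
move=> /occurs_pullE[kT sub] /occurs_pullE[kT' sub'].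
move=> /andP[kj jk] /andP[kj' jk'].
have jT : (j < size T)%N by apply: leq_trans jk kT.
have [x Tx] := nP T j TP jT.
have jS : (j - k < size S)%N by rewrite ltn_subLR.
have jS' : (j - k' < size S')%N by rewrite ltn_subLR.
have [|-> jj] := dQ S S' _ _ SQ SQ' jS jS'; last first.
  by split=> //; rewrite -(subKn kj) jj subKn.
by exists (a x); split; [apply: (sub _ jS)|apply: (sub' _ jS')]; rewrite subnKC.
Qed.

Lemma occurs_disjoint S S' T k k' : S \in Q -> S' \in Q -> T \in P ->
  occurs (pull_tower a S) T k -> occurs (pull_tower a S') T k' ->
  (k <= k')%N -> S = S' /\ k = k' \/ (k + size S <= k')%N.
Proof.
move=> SQ SQ' TP o o' kk; case: (leqP (k + size S) k') => h; [by right|left].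
apply: (occurs_uniq SQ SQ' TP o o' (j := k')); first by rewrite kk.
by rewrite leqnn -[ltnLHS]addn0 ltn_add2l; case: sepQ => + _ _; apply.
Qed.

Lemma pos_inj (e e' : E) : rng E e = rng E e' -> pos e = pos e' -> e = e'.
Proof.
move=> rr pp; apply: tower_edge_inj => //; apply: val_inj.
have o := pos_occurs e'; rewrite -pp -rr in o.
have [[]//|] := occurs_disjoint (valP (src E e)) (valP (src E e'))
  (valP (rng E e)) (pos_occurs e) o (leqnn _).
rewrite -[leqRHS]addn0 leq_add2l leqNgt; case: sepQ => -> //; exact: valP.
Qed.

Lemma tower_edges_ordered : ordered E.
Proof.
split.
- by move=> e; rewrite eleE eqxx leqnn.
- move=> e e' /andP[/andP[/eqP rr p1] /andP[_ p2]]; apply: pos_inj => //.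
  by apply/eqP; rewrite eqn_leq; apply/andP.
- move=> e e' e''; rewrite !eleE => /andP[/eqP -> p1] /andP[/eqP -> p2].
  by rewrite eqxx /=; exact: leq_trans p1 p2.
- move=> e e'; rewrite !eleE (eq_sym (rng E e')) -andb_orr leq_total andbT.
  by split=> /eqP.
Qed.

End Edges.

(** * Composition of tower edges *)

(** Both orders are total on the edges with a given range, so a bijection that
    preserves the order also reflects it. *)
Lemma eiso_mono S T (F G : edge_set S T) (h : F -> G) :
  ordered F -> ordered G -> injective h -> (forall g, exists e, h e = g) ->
  (forall e, src G (h e) = src F e) -> (forall e, rng G (h e) = rng F e) ->
  (forall e e', ele F e e' -> ele G (h e) (h e')) -> eiso F G.
Proof.
move=> [rF aF tF cF] [rG aG tG cG] hi /choice[k hk] hs hr hm; exists h.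
split=> //; first by exists k => // e; apply: hi.
move=> e e'; apply/idP/idP => [l|]; last exact: hm.
have /cF/orP[//|l'] : rng F e = rng F e' by rewrite -!hr; apply/cG; rewrite l.
by rewrite (hi e e') ?rF //; apply: aG; rewrite l hm.
Qed.

(** With [occurs_uniq], the occurrences of towers of Q cut T into consecutive
    disjoint blocks. *)
Definition tiled X Y (a : X -> Y) (Q : towers Y) (P : towers X) : Prop :=
  forall T j, T \in P -> (j < size T)%N -> exists S k,
    [/\ S \in Q, (k <= j < k + size S)%N & occurs (pull_tower a S) T k].

Section Composition.
Variables (X Y Z : Type) (a : X -> Y) (b : Y -> Z).
Variables (R : towers Z) (Q : towers Y) (P : towers X).
Hypotheses (sepR : separated R) (sepQ : separated Q) (sepP : separated P).
Hypotheses (tQ : tiled b R Q) (tP : tiled a Q P).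

Lemma occurs_trans S T U k l : occurs (pull_tower b S) T k ->
  occurs (pull_tower a T) U l -> occurs (pull_tower (b \o a) S) U (l + k).
Proof.
move=> /occurs_pullE[kT ST] /occurs_pullE[lU TU]; apply/occurs_pullE; split.
  by rewrite -addnA; apply: leq_trans lU; rewrite leq_add2l.
move=> j jS x; rewrite -addnA => /TU h; apply: (ST j jS).
by apply: h; apply: leq_trans kT; rewrite ltn_add2l.
Qed.

(** The witness T is the block of U that contains the level m.  The level m - l
    of T lies in a block S' of T, and S' and S then occur in U around the same
    level, hence coincide. *)
Lemma occurs_factor S U m : S \in R -> U \in P ->
  occurs (pull_tower (b \o a) S) U m -> exists T k l,
  [/\ T \in Q, (l + k = m)%N, occurs (pull_tower b S) T k
    & occurs (pull_tower a T) U l].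
Proof.
move=> SR UP o; have S0 : (0 < size S)%N by case: sepR => + _ _; apply.
have /occurs_pullE[mU SU] := o.
have mU' : (m < size U)%N.
  by apply: leq_trans mU; rewrite -[ltnLHS]addn0 ltn_add2l.
have [T [l [TQ /andP[lm ml] oT]]] := tP UP mU'.
have mT : (m - l < size T)%N by rewrite ltn_subLR.
have [S' [k [SR' /andP[kl lk] oS]]] := tQ TQ mT.
have o' := occurs_trans oS oT.
have [||SS km] := occurs_uniq sepR sepP SR SR' UP o o' (j := m).
- by rewrite leqnn -[ltnLHS]addn0 ltn_add2l.
- by rewrite -(subnKC lm) leq_add2l kl -addnA ltn_add2l.
- by exists T, k, l; rewrite SS km.
Qed.

Lemma tower_edges_comp :
  eiso (ecomp (tower_edges (pull_tower b) R Q) (tower_edges (pull_tower a) Q P))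
       (tower_edges (pull_tower (b \o a)) R P).
Proof.
set F := tower_edges _ R Q; set G := tower_edges _ Q P.
set H := tower_edges _ R P.
have ok (p : ecomp F G) : exists e : H, [/\ src H e = src F (val p).1,
    rng H e = rng G (val p).2 & pos e = pos (val p).2 + pos (val p).1]%N.
  apply: tower_edge_ex.
  apply: occurs_trans (pos_occurs _); rewrite -(eqP (valP p)).
  exact: pos_occurs.
have [h hP] := choice ok.
(* The height of the first edge stays inside the block given by the second. *)
have tight (p : ecomp F G) :
    (pos (val p).1 < size (val (src G (val p).2)))%N.
  rewrite -(eqP (valP p)); case: (pos_occurs (val p).1) => + _.
  apply: leq_trans; rewrite -[ltnLHS]addn0 ltn_add2l size_map.
  by case: sepR => + _ _; apply; exact: valP.
(* Blocks do not overlap, so the block with the smaller height comes entirely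
   before the other one. *)
have tile (p p' : ecomp F G) : rng G (val p).2 = rng G (val p').2 ->
    (pos (val p).2 <= pos (val p').2)%N -> (val p).2 = (val p').2 \/
    (pos (h p) < pos (h p'))%N.
  move=> rr le; have [_ _ ->] := hP p; have [_ _ ->] := hP p'.
  have o := pos_occurs (val p').2; rewrite -rr in o.
  have [[_ pp]|lt] := occurs_disjoint sepQ sepP (valP (src G (val p).2))
    (valP (src G (val p').2)) (valP (rng G (val p).2)) (pos_occurs _) o le.
    by left; apply: (pos_inj sepQ sepP).
  right; apply: leq_trans (leq_addr _ _); apply: leq_trans lt.
  by rewrite ltn_add2l; exact: tight.
have mono (p p' : ecomp F G) : ele (ecomp F G) p p' -> ele H (h p) (h p').
  rewrite !eleE; have [_ -> pp] := hP p; have [_ -> pp'] := hP p'.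
  case/orP=> [/andP[/negP ne /andP[/eqP rr le]]|/andP[/eqP gg /andP[_ le]]].
    have {}rr : rng G (val p).2 = rng G (val p').2 := rr.
    by rewrite rr eqxx /=; case: (tile p p' rr le) => [/eqP//|/ltnW].
  by rewrite gg eqxx pp pp' gg leq_add2l.
have oFG : ordered (ecomp F G).
  by apply: ecomp_ordered; exact: tower_edges_ordered.
have oH : ordered H by exact: tower_edges_ordered.
apply: (@eiso_mono _ _ _ _ h) => //.
- move=> p p' hh; have [s1 r1 p1] := hP p; have [s2 r2 p2] := hP p'.
  have rr : rng G (val p).2 = rng G (val p').2 by rewrite -r1 hh.
  have gg : (val p).2 = (val p').2.
    case: (leqP (pos (val p).2) (pos (val p').2)) => [|/ltnW] le.
      by case: (tile p p' rr le) => //; rewrite hh ltnn.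
    by case: (tile p' p (esym rr) le) => //; rewrite hh ltnn.
  have ff : (val p).1 = (val p').1.
    apply: tower_edge_inj; first by rewrite -s1 hh.
      by rewrite (eqP (valP p)) (eqP (valP p')) gg.
    by apply/eqP; rewrite -(eqn_add2l (pos (val p).2)) -p1 hh p2 gg.
  by apply: val_inj; case: (val p) (val p') ff gg => ? ? [? ?] /= -> ->.
- move=> e; have [T [k [l [TQ lk oS oT]]]] :=
    occurs_factor (valP (src H e)) (valP (rng H e)) (pos_occurs e).
  have [f [fs fr fp]] := @tower_edge_ex _ _ b R Q (src H e) [` TQ]%fset k oS.
  have [g [gs gr gp]] := @tower_edge_ex _ _ a Q P [` TQ]%fset (rng H e) l oT.
  have fg : rng F (f, g).1 == src G (f, g).2.
    by apply/eqP; exact: etrans fr (esym gs).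
  pose p : ecomp F G :=
    exist (fun p : F * G => rng F p.1 == src G p.2) (f, g) fg.
  exists p; have [s1 r1 p1] := hP p; apply: tower_edge_inj.
  + by rewrite s1.
  + by rewrite r1.
  + by rewrite p1 /= fp gp.
- by move=> p; have [-> _ _] := hP p.
- by move=> p; have [_ -> _] := hP p.
Qed.

End Composition.

(** * Blocks of Kakutani-Rokhlin towers *)

Lemma mem_cells X (P : towers X) S i : S \in P -> (i < size S)%N ->
  cells P (nth set0 S i).
Proof. by move=> SP iS; exists S => //; exact: mem_nth. Qed.

Lemma cellsP X (P : towers X) A : cells P A ->
  exists S i, [/\ S \in P, (i < size S)%N & A = nth set0 S i].
Proof.
by case=> S SP AS; exists S, (index A S); rewrite index_mem nth_index.
Qed.

Lemma top_last X (P : towers X) S x : S \in P ->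
  nth set0 S (size S).-1 x -> top P x.
Proof. by move=> SP Sx; exists S => //; rewrite -nth_last. Qed.

Lemma top_nth X (P : towers X) S i x : separated P -> S \in P ->
  (i < size S)%N -> nth set0 S i x -> top P x -> i = (size S).-1.
Proof.
move=> [s0 _ d] SP iS Sx [T TP]; rewrite -nth_last => Tx.
have lT : ((size T).-1 < size T)%N by rewrite prednK // s0.
by have [|-> //] := d S T _ _ SP TP iS lT; exists x.
Qed.

Lemma bottom_nth X (P : towers X) S i x : separated P -> S \in P ->
  (i < size S)%N -> nth set0 S i x -> bottom P x -> i = 0%N.
Proof.
move=> [s0 _ d] SP iS Sx [T TP]; rewrite -nth0 => Tx.
by have [|//] := d S T _ _ SP TP iS (s0 _ TP); exists x.
Qed.

Lemma kr_separated (X : topologicalType) (phi : X -> X) x0 P :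
  kr_partition phi x0 P -> separated P.
Proof.
case=> [[s0 c _ d] _ _ _]; split=> // S i SP iS.
by have [] := c _ (mem_cells SP iS).
Qed.

Lemma pull_towersP X Y (a : X -> Y) (Q : towers Y) A :
  cells (pull_towers a Q) A <->
  exists S i, [/\ S \in Q, (i < size S)%N & A = a @^-1` nth set0 S i].
Proof.
split=> [/cellsP[_ [i [/imfsetP[S /= SQ ->]]]]|[S [i [SQ iS ->]]]].
  by rewrite size_map nth_pull; exists S, i.
rewrite -nth_pull; apply: mem_cells; last by rewrite size_map.
exact: in_imfset.
Qed.

Lemma top_pull X Y (a : X -> Y) (Q : towers Y) :
  top (pull_towers a Q) = a @^-1` top Q.
Proof.
apply/seteqP; split=> x.
  move=> [_ /imfsetP[S /= SQ ->]]; rewrite -nth_last nth_pull size_map nth_last.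
  by exists S.
move=> [S SQ Sx]; exists (pull_tower a S); first exact: in_imfset.
by rewrite -nth_last nth_pull size_map nth_last.
Qed.

Lemma pull_tower_id X : pull_tower (@id X) = id.
Proof. by apply: funext => S; rewrite /pull_tower -[RHS]map_id. Qed.

Lemma pull_towers_id X (P : towers X) : pull_towers id P = P.
Proof.
rewrite /pull_towers pull_tower_id; apply/fsetP => S.
apply/imfsetP/idP => [[S' SP ->] //|SP]; by exists S.
Qed.

Section Tiling.
Variables (X Y : topologicalType) (phi : X -> X) (psi : Y -> Y).
Variables (x0 : X) (y0 : Y) (a : X -> Y) (Q : towers Y) (P : towers X).
Hypotheses (krP : kr_partition phi x0 P) (krQ : kr_partition psi y0 Q).
Hypothesis equi : forall x, a (phi x) = psi (a x).
Hypothesis ref : refines (pull_towers a Q) P.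
Hypothesis tops : top P `<=` top (pull_towers a Q).

Let sepP := kr_separated krP.
Let sepQ := kr_separated krQ.

Let below T j S i := nth set0 T j `<=` a @^-1` nth set0 S i.

Let locate T j : T \in P -> (j < size T)%N ->
  exists S i, [/\ S \in Q, (i < size S)%N & below T j S i].
Proof.
move=> TP jT.
have [A /pull_towersP[S [i [SQ iS ->]]] sub] := ref (mem_cells TP jT).
by exists S, i.
Qed.

Let climb T j S i : T \in P -> S \in Q -> (j.+1 < size T)%N ->
  (i.+1 < size S)%N -> below T j S i -> below T j.+1 S i.+1.
Proof.
case: krP krQ => _ upP _ _ [_ upQ _ _] TP SQ jT iS sub z.
rewrite -upP // => -[x /sub Sx <-].
by rewrite /preimage /= equi -upQ //; exists (a x).
Qed.

(** The last level of T lies in the top of P, hence over the top of Q. *)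
Let at_top T j S i : T \in P -> S \in Q -> (j < size T)%N -> (i < size S)%N ->
  below T j S i -> (i.+1 < size S)%N -> (j.+1 < size T)%N.
Proof.
move=> TP SQ jT iS sub iS1; case: (ltnP j.+1 (size T)) => // Tj.
have jE : j = (size T).-1.
  by apply/eqP; rewrite -eqSS prednK ?(leq_trans _ jT)// eqn_leq jT.
have [_ /(_ T j TP jT)[x Tx] _] := sepP.
have : top P x by apply: (top_last TP); rewrite -jE.
move=> /tops; rewrite top_pull => /(top_nth sepQ SQ iS (sub x Tx)) iE.
by move: iS1; rewrite {1}iE prednK ?ltnn //; exact: leq_ltn_trans iS.
Qed.

(** A point of the first level of T is the image of a point of the top of P,
    which lies over the top of Q. *)
Let at_bottom T S i : T \in P -> S \in Q -> (i < size S)%N ->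
  below T 0 S i -> i = 0%N.
Proof.
move=> TP SQ iS sub; have [s0 nP _] := sepP.
have [x Tx] := nP T 0%N TP (s0 T TP).
have : bottom P x by exists T => //; rewrite -nth0.
case: krP krQ => _ _ _ <- [_ _ _ bQ] [x' /tops]; rewrite top_pull => tx' x'E.
apply: (bottom_nth sepQ SQ iS (sub x Tx)).
by rewrite -bQ -x'E equi; exists (a x').
Qed.

(** If the level j of T were over the last level of a tower, the level j + 1
    would be over the bottom of Q. *)
Let descend T j S i : T \in P -> S \in Q -> (j.+1 < size T)%N ->
  (i.+1 < size S)%N -> below T j.+1 S i.+1 -> below T j S i.
Proof.
move=> TP SQ jT iS sub; have [S' [i' [SQ' iS' sub']]] := locate TP (ltnW jT).
have [_ /(_ T j.+1 TP jT)[x Tx] _] := sepP.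
have [_ _ dQ] := sepQ.
case: (ltnP i'.+1 (size S')) => h.
  have [|SS [ii]] := dQ S S' _ _ SQ SQ' iS h; last by rewrite SS ii.
  by exists (a x); split; [exact: sub|exact: (climb TP SQ' jT h sub')].
have iE : i' = (size S').-1.
  by apply/eqP; rewrite -eqSS prednK ?(leq_trans _ iS')// eqn_leq iS'.
have := sub x Tx; case: krP krQ => _ upP _ _ [_ _ _ bQ].
move: Tx; rewrite -upP // => -[x' /sub' Sx' xE] Sx.
have bx : bottom Q (a x).
  rewrite -bQ -xE equi; exists (a x') => //; apply: (top_last SQ').
  by rewrite -iE.
by have := bottom_nth sepQ SQ iS Sx bx.
Qed.

(** The level j of T lies over the level i of some S.  Descending from there, T
    follows S down to its first level, reached at the height j - i; climbing
    again, it follows S up to its last level. *)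
Lemma kr_tiled : tiled a Q P.
Proof.
move=> T j TP jT; have [S [i [SQ iS sub]]] := locate TP jT.
have start : (i <= j)%N /\ below T (j - i) S 0.
  elim: i j jT iS sub => [|i IH] [|j] jT iS sub; rewrite ?subn0 //.
    by have := at_bottom TP SQ iS sub.
  rewrite subSS; apply: IH; [exact: ltnW|exact: ltnW|exact: descend].
have [ij {}sub] := start; exists S, (j - i)%N; split=> //.
  by rewrite leq_subr /= -ltn_subLR ?leq_subr// subKn.
have run l : (l < size S)%N ->
    (j - i + l < size T)%N /\ below T (j - i + l) S l.
  elim: l => [|l IH] lS.
    by rewrite addn0; split=> //; exact: leq_ltn_trans (leq_subr _ _) jT.
  have [lT subl] := IH (ltnW lS); rewrite addnS.
  have lT1 := at_top TP SQ lT (ltnW lS) subl lS.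
  by split=> //; exact: climb.
apply/occurs_pullE; split; last by move=> l /run[].
have S0 : (0 < size S)%N by exact: leq_ltn_trans iS.
have [|+ _] := run (size S).-1; first by rewrite prednK.
by rewrite -addnS prednK.
Qed.

Lemma tiled_rng (T : P) :
  exists e, rng (tower_edges (pull_tower a) Q P) e = T.
Proof.
have T0 : (0 < size (val T))%N by case: sepP => + _ _; apply; exact: valP.
have [S [k [SQ _ o]]] := kr_tiled (valP T) T0.
by have [e [_ eT _]] := @tower_edge_ex _ _ a Q P [` SQ]%fset T k o; exists e.
Qed.

(** The hypothesis holds if a is surjective.  It cannot be dropped: the first
    level of S may miss the image of a. *)
Lemma tiled_src (S : Q) : (exists x, nth set0 (val S) 0 (a x)) ->
  exists e, src (tower_edges (pull_tower a) Q P) e = S.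
Proof.
move=> [x Sx].
have [[_ _ /(_ x)[A /cellsP[T [j [TP jT ->]]] Tx] _] _ _ _] := krP.
have [S' [k [SQ' /andP[kj jk] o]]] := kr_tiled TP jT.
have /occurs_pullE[_ sub] := o.
have jS : (j - k < size S')%N by rewrite ltn_subLR.
have [s0 _ dQ] := sepQ.
have [|SS _] := dQ (val S) S' 0%N (j - k)%N (valP S) SQ' (s0 _ (valP S)) jS.
  by exists (a x); split=> //; apply: sub => //; rewrite subnKC.
rewrite -SS in o.
by have [e [eS _ _]] := @tower_edge_ex _ _ a Q P S [` TP]%fset k o; exists e.
Qed.

End Tiling.

(** A tower of P that occurs in a tower of P can only be that tower, at height
    0, since the cells are disjoint. *)
Lemma tower_edges_eid X (P : towers X) : separated P ->
  eiso (tower_edges (pull_tower id) P P) (eid P).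
Proof.
move=> sepP; have [s0 nP dP] := sepP.
have diag (e : tower_edges (pull_tower id) P P) :
    src _ e = rng _ e /\ pos e = 0%N.
  have /occurs_pullE[kT sub] := pos_occurs e.
  have S0 : (0 < size (val (src _ e)))%N by apply: s0; exact: valP.
  have kT' : (pos e < size (val (rng _ e)))%N.
    by apply: leq_trans kT; rewrite -[ltnLHS]addn0 ltn_add2l.
  have [x Tx] := nP _ _ (valP (rng _ e)) kT'.
  have [|ST ->] := dP _ _ _ _ (valP (src _ e)) (valP (rng _ e)) S0 kT'.
    by exists x; split=> //; apply: (sub 0%N) => //; rewrite addn0.
  by split=> //; exact: val_inj.
apply: (@eiso_mono _ _ _ (eid P) (src (tower_edges (pull_tower id) P P))).
- exact: tower_edges_ordered.
- exact: eid_ordered.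
- move=> e e' ee; have [se pe] := diag e; have [se' pe'] := diag e'.
  by apply: tower_edge_inj => //; [rewrite -se -se'|rewrite pe pe'].
- move=> S; have [|e [eS _ _]] := @tower_edge_ex _ _ id P P S S 0%N.
    by apply/occurs_pullE; split=> // j jS; rewrite add0n.
  by exists e.
- by [].
- by move=> e; have [] := diag e.
- move=> e e' /andP[/eqP rr _]; have [se _] := diag e; have [se' _] := diag e'.
  by apply/eqP; rewrite se se'.
Qed.

(** * The diagram of a system *)

Section System.
Variables (R : realType) (X : sds R).

Lemma part_kr n : kr_partition (@act R X) (base X) (part X n).
Proof. by case: (sds_kr X) => [[]]. Qed.

Lemma part_separated n : separated (part X n).
Proof. exact: kr_separated (part_kr n). Qed.

Lemma part0 : part X 0 = [fset [:: setT]]%fset.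
Proof. by case: (sds_kr X) => [[]]. Qed.

Lemma refines_part k l : (k <= l)%N -> refines (part X k) (part X l).
Proof.
move=> kl; rewrite -(subnKC kl); elim: (l - k)%N => [|d IH].
  by rewrite addn0 => A PA; exists A.
case: (sds_kr X) => _ ref _ _ _; rewrite addnS => A PA.
have [B PB AB] := ref _ _ PA; have [C PC BC] := IH _ PB.
by exists C => //; exact: subset_trans AB BC.
Qed.

Lemma top_part k l : (k <= l)%N -> top (part X l) `<=` top (part X k).
Proof.
move=> kl; rewrite -(subnKC kl); elim: (l - k)%N => [|d IH].
  by rewrite addn0.
(* The tops are assumed to decrease from n = 1 on; P_0 has top X. *)
rewrite addnS; apply: subset_trans IH; case: (posnP (k + d)) => [->|kd].
  by rewrite part0 => x _; exists [:: setT] => //; rewrite inE.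
by case: (sds_kr X) => _ _ + _ _; apply.
Qed.

Lemma part_tiled k l : (k <= l)%N -> tiled id (part X k) (part X l).
Proof.
move=> kl; apply: (kr_tiled (part_kr l) (part_kr k)) => //.
  by rewrite pull_towers_id; exact: refines_part.
by rewrite top_pull; exact: top_part.
Qed.

Lemma card_part0 : #|vert (kr_diagram X) 0| = 1%N.
Proof. by rewrite /= -cardfE part0 cardfs1. Qed.

Lemma kr_diagramE n : bedge (kr_diagram X) n =
  tower_edges (pull_tower id) (part X n) (part X n.+1).
Proof. by rewrite pull_tower_id. Qed.

Lemma kr_diagram_is_obd : is_obd (kr_diagram X).
Proof.
have ref n : refines (pull_towers id (part X n)) (part X n.+1).
  by rewrite pull_towers_id; exact: refines_part.
have tops n : top (part X n.+1) `<=` top (pull_towers id (part X n)).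
  by rewrite top_pull; exact: top_part.
have rngs n (w : part X n.+1) : exists e, rng (bedge (kr_diagram X) n) e = w.
  by rewrite kr_diagramE; exact: (tiled_rng (part_kr n.+1) (part_kr n)).
have inh n : exists S : part X n, True.
  by have [_ _ [S SP _] _] := part_kr n; exists [` SP]%fset.
split=> //.
- split; last exact: card_part0.
  by move=> n; have [S _] := inh n; apply/card_gt0P; exists S.
- move=> n; have [S _] := inh n.+1; have [e _] := rngs n S.
  by apply/card_gt0P; exists e.
- move=> n; rewrite kr_diagramE.
  by apply: tower_edges_ordered; exact: part_separated.
- move=> n S; rewrite kr_diagramE.
  apply: (tiled_src (part_kr n.+1) (part_kr n)) => //.
  have [s0 nP _] := part_separated n.
  have [x Sx] := nP _ 0%N (valP S) (s0 _ (valP S)).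
  by exists x.
Qed.

End System.

(** The level of the diagram of X is a free parameter, so that the edge sets of
    the diagrams, of their telescopings and of the premorphisms for all choices
    of indices are instances of one family. *)
Definition kr_edges (R : realType) (X Y : sds R) (a : space X -> space Y) n m :
    edge_set (vert (kr_diagram Y) n) (vert (kr_diagram X) m) :=
  tower_edges (pull_tower a) (part Y n) (part X m).

Lemma kr_edges_comp (R : realType) (X Y Z : sds R) (b : space Y -> space Z)
    (a : space X -> space Y) n m p :
  tiled b (part Z n) (part Y m) -> tiled a (part Y m) (part X p) ->
  eiso (ecomp (amb (kr_edges b n m)) (amb (kr_edges a m p)))
       (amb (kr_edges (b \o a) n p)).
Proof.
move=> tb ta; apply: eiso_trans (eiso_sym (amb_comp _ _)) _; apply: amb_eiso.
by apply: tower_edges_comp tb ta; exact: part_separated.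
Qed.

Lemma kr_tele (R : realType) (X : sds R) k d :
  eiso (tele (kr_diagram X) k d) (amb (kr_edges (@id (space X)) k (k + d))).
Proof.
elim: d => [|d IH].
  rewrite addn0; apply: amb_eiso; apply: eiso_sym; apply: tower_edges_eid.
  exact: part_separated.
rewrite addnS [tele _ _ _]/= IH.
rewrite -[tower_edges id _ _]/(bedge (kr_diagram X) (k + d)) kr_diagramE.
apply: (kr_edges_comp (b := id) (a := id)).
  by apply: part_tiled; exact: leq_addr.
exact: part_tiled.
Qed.

Lemma kr_lev (R : realType) (X : sds R) k l : (k <= l)%N ->
  eiso (lev (kr_diagram X) k l) (amb (kr_edges (@id (space X)) k l)).
Proof. by move=> kl; rewrite /lev kr_tele subnKC //; exact: eiso_refl. Qed.

(** * The premorphisms of a map of systems *)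

Section Cells.
Variable R : realType.

Lemma open_cell (Z : sds R) n A : cells (part Z n) A -> open A.
Proof. by case: (part_kr Z n) => [[_ c _ _] _ _ _] /c[[]]. Qed.

Lemma cell_eq (Z : sds R) n A B x :
  cells (part Z n) A -> cells (part Z n) B -> A x -> B x -> A = B.
Proof.
move=> /cellsP[S [i [SP iS ->]]] /cellsP[T [j [TP jT ->]]] Sx Tx.
have [_ _ d] := part_separated Z n.
by have [|-> -> //] := d _ _ _ _ SP TP iS jT; exists x.
Qed.

Lemma top_cell (Z : sds R) n A x y : cells (part Z n) A -> A x -> A y ->
  top (part Z n) x -> top (part Z n) y.
Proof.
move=> /cellsP[S [i [SP iS ->]]] Sx Sy tx.
have iE := top_nth (part_separated Z n) SP iS Sx tx.
by apply: (top_last SP); rewrite -iE.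
Qed.

Lemma cell_at (Z : sds R) n x : exists2 A, cells (part Z n) A & A x.
Proof. by case: (part_kr Z n) => [[]]. Qed.

End Cells.

Section Morphism.
Variables (onto : bool) (R : realType) (X Y : sds R) (a : sds_hom onto X Y).

Lemma sds_equi x : a (@act R X x) = @act R Y (a x).
Proof. by case: a => f [_ + _ _] /=; move/(congr1 (@^~ x)). Qed.

(** By compactness it is enough to find, for each x, a neighbourhood of x and an
    index from which on both conditions hold at the points of this
    neighbourhood.  For the refinement, a basic cell U around x inside the
    inverse image of a cell of Y will do: all later cells that meet U are
    contained in U.  For the tops, either a x is in the top of Q_n, as are then
    all points of its cell, or x is not the base point and so it leaves the
    tops of X at some index, with its whole cell. *)
Lemma adapted_eventually n : exists N, forall m, (N <= m)%N ->
  refines (pull_towers a (part Y n)) (part X m) /\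
  top (part X m) `<=` top (pull_towers a (part Y n)).
Proof.
have [ca _ abase _] : is_sds_mor onto a by exact: (proj2_sig a).
have compX : compact [set: space X] by case: (sds_em X) => [[]].
have [_ _ _ tops [_ bas]] := sds_kr X.
pose good m x := (forall A, cells (part X m) A -> A x ->
    exists2 B, cells (part Y n) B & A `<=` a @^-1` B) /\
  (top (part X m) x -> top (part Y n) (a x)).
suff: \forall m \near \oo, [set: space X] `<=` good m.
  move=> [N _ NP]; exists N => m /NP gm; split=> [A PA|].
    have [_ [x Ax]] : clopen A /\ A !=set0.
      by case: (part_kr X m) => [[_ + _ _] _ _ _]; exact.
    have [B /cellsP[S [i [SQ iS ->]]] AB] := (gm x I).1 A PA Ax.
    exists (a @^-1` nth set0 S i) => //.
    by apply/pull_towersP; exists S, i.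
  by rewrite top_pull => x tx; exact: (gm x I).2.
move/compact_near_coveringP: compX; apply => x _.
have [B QB Bx] := cell_at n (a x).
have [U [[N1 _ PU] Ux] UB] :
    filter_from [set U | (\bigcup_n cells (part X n)) U /\ U x] id
      (a @^-1` B).
  by apply: bas; apply: ca; exact: open_nbhs_nbhs (conj (open_cell QB) Bx).
have nU : nbhs x U by apply: open_nbhs_nbhs; split=> //; exact: open_cell PU.
have [N2 [V [nV VP]]] : exists N2 V, nbhs x V /\ forall x', V x' ->
    top (part X N2) x' -> top (part Y n) (a x').
  have [tx|ntx] := pselect (top (part Y n) (a x)).
    exists 0%N, U; split=> // x' /UB Bx' _; exact: (top_cell QB Bx).
  have [N2 N2x] : exists N2, ~ top (part X N2) x.
    apply: contra_notP ntx => /forallNP h.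
    have -> : x = base X.
      by rewrite -[_ = _]/([set base X] x) -tops => k _; exact: contrapT (h k).
    by rewrite abase; case: (part_kr Y n).
  have [V PV Vx] := cell_at N2 x; exists N2, V; split.
    by apply: open_nbhs_nbhs; split=> //; exact: open_cell PV.
  by move=> x' Vx' tx'; case: N2x; exact: (top_cell PV Vx').
exists (U `&` V, [set m | (maxn N1 N2 <= m)%N]) => /=.
  by split; [exact: filterI|exists (maxn N1 N2)].
move=> [x' m] [/= [Ux' Vx'] mN]; split=> [A PA Ax'|tx'].
  have [A' PA' AA'] := refines_part (leq_trans (leq_maxl N1 N2) mN) PA.
  exists B => //; apply: subset_trans UB.
  by rewrite -(cell_eq PA' PU (AA' _ Ax') Ux').
by apply: VP => //; exact: top_part (leq_trans (leq_maxr N1 N2) mN) _ tx'.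
Qed.

Lemma adapted_ex : exists f, adapted a f.
Proof.
have [N NP] := choice adapted_eventually.
pose f := fix f n := if n is n'.+1 then maxn (f n').+1 (N n) else 0%N.
have fS n : (f n < f n.+1)%N by rewrite leq_max leqnn.
have fn n : (n <= f n)%N.
  by elim: n => // n IH; exact: leq_ltn_trans (fS n).
exists f; split.
  by split=> // [n|k]; [exact: ltnW|exists k.+1; exact: fn].
move=> [|n]; last by apply: NP; rewrite leq_maxr.
rewrite top_pull !part0; split=> [A /cellsP[S [i [_ _ ->]]]|x _].
  exists setT => //; apply/pull_towersP; exists [:: setT], 0%N.
  by rewrite inE /= preimage_setT.
by exists [:: setT] => //; rewrite inE.
Qed.

Section Adapted.
Variables (f : nat -> nat) (af : adapted a f).

Lemma adapted_tiled n m : (f n <= m)%N -> tiled a (part Y n) (part X m).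
Proof.
move=> fm; have [ref tops] := af.2 n.
apply: (kr_tiled (part_kr X m) (part_kr Y n) sds_equi).
  move=> A PA; have [B PB AB] := refines_part fm PA.
  by have [C PC BC] := ref _ PB; exists C => //; exact: subset_trans AB BC.
exact: subset_trans (top_part fm) tops.
Qed.

(** The right-hand side does not mention f: this is why the class of the
    premorphism depends on a only. *)
Lemma kr_edges_lev n k : (f n <= k)%N ->
  eiso (ecomp (amb (kr_edges a n (f n))) (lev (kr_diagram X) (f n) k))
       (amb (kr_edges a n k)).
Proof.
move=> fk; rewrite (kr_lev X fk); apply: (kr_edges_comp (b := a) (a := id)).
  exact: adapted_tiled.
exact: part_tiled.
Qed.

(** In the square condition, both sides are the edge set of a between the
    partition n of Y and the partition f (n + 1) of X. *)
Lemma kr_premor_is_premor : is_premor onto (kr_premor a f).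
Proof.
have [[f0 fm fu] rt] := af.
have rngs n w : exists e, rng (pedge (kr_premor a f) n) e = w.
  apply: (tiled_rng (part_kr X (f n)) (part_kr Y n) sds_equi).
    exact: (rt n).1.
  exact: (rt n).2.
have ne n : exists e : pedge (kr_premor a f) n, True.
  have [_ _ [S SP _] _] := part_kr X (f n).
  by have [e _] := rngs n [` SP]%fset; exists e.
split=> //.
- split=> [n|]; first by have [e _] := ne n; apply/card_gt0P; exists e.
  have [e _] := ne 0%N; apply/eqP/fintype1P; exists e => e'.
  have /eqP/fintype1P[S SE] := card_part0 Y.
  have /eqP/fintype1P[T TE] := card_part0 X; rewrite -f0 in T TE.
  apply: pos_inj; try exact: part_separated.
    by rewrite (TE (rng _ e')) (TE (rng _ e)).
  have p0 (d : pedge (kr_premor a f) 0) : pos d = 0%N.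
    have /occurs_pullE[h _] := pos_occurs d.
    have PE : part X (f 0) = [fset [:: setT]]%fset by rewrite f0 part0.
    have SE' : val (src _ d) = [:: setT].
      by apply/fset1P; rewrite -(part0 Y); exact: valP.
    have TE' : val (rng _ d) = [:: setT].
      by apply/fset1P; rewrite -PE; exact: valP.
    by move: h; rewrite SE' TE' /= addn1 ltnS leqn0 => /eqP.
  by rewrite !p0.
- by move=> n; apply: tower_edges_ordered; exact: part_separated.
- split=> // tt n S.
  have [ref tops] := rt n.
  apply: (tiled_src (part_kr X (f n)) (part_kr Y n) sds_equi ref tops).
  have [s0 nP _] := part_separated Y n.
  have [y Sy] := nP _ 0%N (valP S) (s0 _ (valP S)).
  have [_ _ _ surj] : is_sds_mor onto a by exact: (proj2_sig a).
  by have [x _ xy] := surj tt y I; exists x; rewrite xy.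
- move=> n; apply: eiso_trans (eiso_sym (kr_edges_lev (fm n))).
  rewrite kr_diagramE; apply: (kr_edges_comp (b := id) (a := a)).
    exact: part_tiled.
  exact: adapted_tiled.
Qed.

End Adapted.
End Morphism.

(** * Functoriality *)

Lemma kr_pequiv_id onto (R : realType) (X : sds R) (PO : is_obd (kr_diagram X))
    f (H : @is_premor onto (Obd PO) (Obd PO) (kr_premor (@id (space X)) f)) :
  adapted (sds_id onto X) f ->
  pequiv (Premor H) (pid onto (Obd PO)).
Proof.
move=> af; apply/pequiv_stable => n; exists (maxn (f n) n).
split; [exact: leq_maxl|exact: leq_maxr|].
apply: eiso_trans (kr_edges_lev af (leq_maxl _ _)) _; apply: eiso_sym.
apply: eiso_trans _ (kr_lev X (leq_maxr (f n) n)).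
apply: (@ecomp_idl (Obd PO)); first exact: (@lev_ordered (Obd PO)).
exact: (@tele_src (Obd PO)).
Qed.

Lemma kr_pequiv_comp onto (R : realType) (X Y Z : sds R)
    (PX : is_obd (kr_diagram X)) (PY : is_obd (kr_diagram Y))
    (PZ : is_obd (kr_diagram Z))
    (b : sds_hom onto Y Z) (a : sds_hom onto X Y) f g h
    (F : @is_premor onto (Obd PY) (Obd PX) (kr_premor a f))
    (G : @is_premor onto (Obd PZ) (Obd PY) (kr_premor b g))
    (H : @is_premor onto (Obd PZ) (Obd PX) (kr_premor (sds_cmp b a) h)) :
  adapted a f -> adapted b g -> adapted (sds_cmp b a) h ->
  pequiv (Premor H) (Defs.pcomp (Premor F) (Premor G)).
Proof.
move=> af bg ch; apply/pequiv_stable => n; exists (maxn (h n) (f (g n))).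
split; [exact: leq_maxl|exact: leq_maxr|].
set k := maxn _ _; have fk : (f (g n) <= k)%N by exact: leq_maxr.
apply: eiso_trans (kr_edges_lev ch (leq_maxl _ _)) _; apply: eiso_sym.
have bt := adapted_tiled bg (leqnn (g n)).
apply: eiso_trans _ (kr_edges_comp bt (adapted_tiled af fk)).
rewrite -(kr_edges_lev af fk) ecompA.
by apply: ecomp_eiso; [exact: amb_comp|exact: eiso_refl].
Qed.

Lemma kr_pequiv onto (R : realType) (X Y : sds R) (PX : is_obd (kr_diagram X))
    (PY : is_obd (kr_diagram Y)) (a : sds_hom onto X Y) f g
    (F : @is_premor onto (Obd PY) (Obd PX) (kr_premor a f))
    (G : @is_premor onto (Obd PY) (Obd PX) (kr_premor a g)) :
  adapted a f -> adapted a g -> pequiv (Premor F) (Premor G).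
Proof.
move=> af ag; apply/pequiv_stable => n; exists (maxn (f n) (g n)).
split; [exact: leq_maxl|exact: leq_maxr|].
apply: eiso_trans (kr_edges_lev af (leq_maxl _ _)) _; apply: eiso_sym.
exact: (kr_edges_lev ag (leq_maxr (f n) (g n))).
Qed.

(* [b = true]: surjective maps of systems, and premorphisms in which every
   vertex emits an edge.  [b = false]: all maps of systems, and premorphisms
   without that condition, which fails for every map that is not surjective. *)
Theorem proposition3p7 (R : realType) (b : bool) :
  exists (PO : forall X : SDS b R, is_obd (kr_diagram X))
         (PM : forall X Y : SDS b R,
            hom X Y -> @hom (OBD b) (Obd (PO Y)) (Obd (PO X))),
    (forall (X Y : SDS b R) (a : hom X Y),
       (exists f : nat -> nat, adapted (sds_fun a) f) /\
       (forall f : nat -> nat, adapted (sds_fun a) f ->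
          exists H : @is_premor b (Obd (PO Y)) (Obd (PO X))
                       (kr_premor (sds_fun a) f),
            PM X Y a = mor (Premor H))) /\
    @contravariant_functor (SDS b R) (OBD b) (fun X => Obd (PO X)) PM.
Proof.
pose PO (X : SDS b R) := kr_diagram_is_obd X.
pose idx (X Y : SDS b R) (a : sds_hom b X Y) := projT1 (cid (adapted_ex a)).
have idxP (X Y : SDS b R) (a : sds_hom b X Y) : adapted a (idx X Y a).
  by rewrite /idx; case: cid.
pose pm (X Y : SDS b R) (a : sds_hom b X Y) :
    premor b (Obd (PO Y)) (Obd (PO X)) :=
  Premor (kr_premor_is_premor (idxP X Y a)).
exists PO, (fun X Y a => mor (pm X Y a)); split.
  move=> X Y a; split; first exact: adapted_ex.
  move=> f af; exists (kr_premor_is_premor af).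
  exact/mor_eq/(kr_pequiv _ _ (idxP X Y a) af).
split=> [X|X Y Z g f] /=.
  exact/mor_eq/(kr_pequiv_id _ (idxP X X (sds_id b X))).
rewrite obd_cmpE.
exact/mor_eq/(kr_pequiv_comp _ _ _ (idxP X Y f) (idxP Y Z g)
  (idxP X Z (sds_cmp g f))).
Qed.
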